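(* Let $\lambda$ be a nonzero real number, let $m\ge 1$ be an integer and let $x$ be a real number. For every integer $n\ge 0$, $$d_{m,\lambda}(n,x)=e^{-\frac{x}{\lambda m}}\sum_{k=0}^{\infty}\frac{x^{k}}{k!\,m^{k}\lambda^{k}}(\lambda mk+1)^{n}.$$
   Context: For a nonzero real $\lambda$, the generalized falling factorials are $(x)_{0,\lambda}=1$ and $(x)_{n,\lambda}=x(x-\lambda)\cdots(x-(n-1)\lambda)$ for $n\ge 1$. For an integer $m\ge 1$, the $\lambda$-analogues of the Whitney-type Stirling numbers of the second kind $W_{m,\lambda}(n,k)$ ($0\le k\le n$) are the real numbers uniquely determined by the polynomial identities in $x$ $$(mx+1)^{n}=\sum_{k=0}^{n}W_{m,\lambda}(n,k)m^{k}(x)_{k,\lambda},\quad n\ge 0.$$ The $\lambda$-analogues of Dowling polynomials are $d_{m,\lambda}(n,x)=\sum_{k=0}^{n}W_{m,\lambda}(n,k)x^{k}$ for $n\ge 0$. Convention: $0^0=1$. *)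

(* Defs.v *)
From HB Require Import structures.
From mathcomp Require Import all_boot all_order all_algebra.
From mathcomp Require Import all_classical all_reals all_analysis.
From mathcomp Require Import ring.

Set Implicit Arguments.
Unset Strict Implicit.
Unset Printing Implicit Defensive.

Import Order.TTheory GRing.Theory Num.Theory.
Import numFieldNormedType.Exports.

Local Open Scope classical_set_scope.
Local Open Scope ring_scope.

(* Stated over any commutative ring so that it can be used with 'X : {poly R}
   (and lambda a constant polynomial) as well as with scalars. *)
Definition gfalling (A : comNzRingType) (lam x : A) (n : nat) : A :=
  \prod_(i < n) (x - i%:R * lam).

Definition is_whitney2 (R : realType) (m : nat) (lam : R) (n : nat)
    (w : {ffun 'I_n.+1 -> R}) : Prop :=
  (m%:R *: 'X + 1) ^+ n =
  \sum_(k < n.+1) (w k * m%:R ^+ k) *: gfalling lam%:P 'X k :> {poly R}.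

(* By is_whitney2_unique below, the default value 0 of xget is only used for
   m = 0. *)
Definition whitney2 (R : realType) (m : nat) (lam : R) (n : nat) :
    {ffun 'I_n.+1 -> R} :=
  xget [ffun=> 0] [set w | is_whitney2 m lam w].

Definition dowling (R : realType) (m : nat) (lam : R) (n : nat) (x : R) : R :=
  \sum_(k < n.+1) whitney2 m lam n k * x ^+ k.

Lemma gfalling_polyE (R : realType) (lam : R) n :
  gfalling lam%:P 'X n = \prod_(i < n) ('X - (i%:R * lam)%:P) :> {poly R}.
Proof. by apply: eq_bigr => i _; rewrite polyCM polyC_natr. Qed.

Lemma is_whitney2_unique (R : realType) (m : nat) (lam : R) (n : nat) :
  (0 < m)%N -> exists! w : {ffun 'I_n.+1 -> R}, is_whitney2 m lam w.
Proof.
move=> m0; have mN0 : m%:R != 0 :> R by rewrite pnatr_eq0 -lt0n.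
pose p k : {poly R} := gfalling lam%:P 'X k.
have free_p : forall N (c : nat -> R),
    \sum_(k < N) c k *: p k = 0 -> forall k, (k < N)%N -> c k = 0.
  elim=> [//|N IH] c; rewrite big_ord_recr /= => H.
  have sz k : size (p k) = k.+1.
    by rewrite /p gfalling_polyE size_prod_XsubC /index_enum -enumT size_enum_ord.
  have cN : c N = 0.
    have := congr1 (fun q : {poly R} => q`_N) H.
    rewrite coefD coefZ coef_sum coef0 big1 ?add0r => [|i _].
      have : p N \is monic by rewrite /p gfalling_polyE monic_prod_XsubC.
      by rewrite monicE lead_coefE sz /= => /eqP ->; rewrite mulr1.
    by rewrite coefZ [(p i)`_N]nth_default ?mulr0// sz.
  move: H; rewrite cN scale0r addr0 => /IH {}IH k.
  by rewrite ltnS leq_eqVlt => /orP[/eqP ->|/IH].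
have [c cE] : exists c : nat -> R,
    (m%:R *: 'X + 1) ^+ n = \sum_(k < n.+1) c k *: p k.
  elim: n => [|n [c cE]].
    by exists (fun=> 1); rewrite expr0 big_ord1 scale1r /p /gfalling big_ord0.
  exists (fun k => (if k is k'.+1 then c k' * m%:R else 0) +
    (if (k < n.+1)%N then c k * (m%:R * (k%:R * lam) + 1) else 0)).
  rewrite exprSr cE mulr_suml.
  under [RHS]eq_bigr do rewrite scalerDl.
  rewrite big_split/= [X in _ = X + _]big_ord_recl/= scale0r add0r.
  rewrite [X in _ = _ + X]big_ord_recr/= ltnn scale0r addr0 -big_split/=.
  apply: eq_bigr => i _; rewrite ltn_ord /bump leq0n/=.
  have -> : p (1 + i)%N = p i * ('X - (i%:R * lam)%:P).
    by rewrite /p !gfalling_polyE add1n big_ord_recr.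
  by rewrite -!mul_polyC !(polyCM, polyCD, polyC1); ring.
exists [ffun k : 'I_n.+1 => c k / m%:R ^+ k]; split.
  rewrite /is_whitney2 cE; apply: eq_bigr => i _.
  by rewrite ffunE divfK// expf_neq0.
move=> w wE; apply/ffunP => i; rewrite ffunE.
apply: (mulIf (expf_neq0 i mN0)); rewrite divfK ?expf_neq0//.
have /(free_p _ (fun k => c k - w (inord k) * m%:R ^+ k)) :
    \sum_(k < n.+1) (c k - w (inord k) * m%:R ^+ k) *: p k = 0.
  under eq_bigr do rewrite scalerBl inord_val.
  by rewrite sumrB -cE wE subrr.
by move=> /(_ i (ltn_ord i))/eqP; rewrite inord_val subr_eq0 => /eqP.
Qed.

(* Main.v *)
(** The series is [x ^ k / (m lam) ^ k / k!] times [(m X + 1) ^ n] evaluated at [X = lam k].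
    The defining identity of the Whitney numbers turns this value into a
    combination of the falling factorials [k (k - 1) ... (k - j + 1)], and the
    factorial moments [sum_k t ^ k / k! * k (k - 1) ... (k - j + 1) = t ^ j e ^ t]
    evaluate the series term by term. *)
Require Import Defs.
From mathcomp Require Import all_boot all_order all_algebra.
From mathcomp Require Import all_classical all_reals all_analysis.
From mathcomp Require Import ring.
Import Order.TTheory GRing.Theory Num.Theory.
Import numFieldNormedType.Exports.
Local Open Scope classical_set_scope.
Local Open Scope ring_scope.

(** Each factor [lam * k - i * lam] equals [lam * (k - i)], so one power of [lam] splits off per
    factor. *)
Lemma gfalling_mul_nat (A : comNzRingType) (lam : A) (k j : nat) :
  gfalling lam (lam * k%:R) j = (k ^_ j)%:R * lam ^+ j.
Proof.
elim: j => [|j IH]; first by rewrite /gfalling big_ord0 mul1r.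
rewrite /gfalling big_ord_recr -/(gfalling lam _ j) /= IH ffactnSr exprSr natrM.
(* Subtraction in [nat] truncates, so [k - j] matches the ring only for [j <= k]; otherwise [k ^_ j]
   is already 0. *)
have [jk|kj] := leqP j k; last by rewrite ffact_small// !mul0r.
by rewrite natrB//; ring.
Qed.

Lemma horner_gfalling (A : comNzRingType) (lam y : A) (j : nat) :
  (gfalling lam%:P 'X j).[y] = gfalling lam y j.
Proof.
rewrite /gfalling horner_prod; apply: eq_bigr => i _.
by rewrite -polyC_natr -polyCM !hornerE.
Qed.

Lemma whitney2P (R : realType) (m : nat) (lam : R) (n : nat) :
  (0 < m)%N -> is_whitney2 m lam (whitney2 m lam n).
Proof.
move=> /(is_whitney2_unique lam n)[w [wP _]].
exact: (@xgetPex _ _ [set w | is_whitney2 m lam w] (ex_intro _ w wP)).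
Qed.

(** The terms with [k < j] vanish and [k ^_ j / k! = 1 / (k - j)!] for the others, so the partial
    sum of length [N + j] is exactly [t ^ j] times the exponential partial sum of length [N]. *)
Lemma cvg_series_exp_ffact (R : realType) (t : R) (j : nat) :
  series (fun k => t ^+ k / k`!%:R * (k ^_ j)%:R) @ \oo --> t ^+ j * expR t.
Proof.
rewrite -(cvg_shiftn j).
have -> : (fun N => series (fun k => t ^+ k / k`!%:R * (k ^_ j)%:R) (N + j)%N)
    = (fun N => t ^+ j * series (exp_coeff t) N).
  apply/funext => N; rewrite /series /= mulr_sumr (big_cat_nat (n := j)) ?leq_addl//=.
  rewrite big_nat_cond big1 ?add0r; last first.
    by move=> i /andP[/andP[_ ij] _]; rewrite ffact_small ?mulr0.
  rewrite -{1}[j]add0n big_addn addnK; apply: eq_bigr => i _.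
  rewrite /exp_coeff /= exprD -(ffact_fact (leq_addl i j)) addnK natrM invfM.
  have F0 : ((i + j) ^_ j)%:R != 0 :> R by rewrite pnatr_eq0 -lt0n ffact_gt0 leq_addl.
  by rewrite -!mulrA mulrCA [X in _ * (_ * X)]mulrCA mulVf// mulr1.
by apply: cvgMl_tmp; exact: is_cvg_series_exp_coeff.
Qed.

Theorem theorem11 (R : realType) (lam : R) (m : nat) (x : R) (n : nat)
    (hlam : lam != 0) (hm : (1 <= m)%N) :
  let u : R^nat := fun k =>
    x ^+ k / (k`!%:R * m%:R ^+ k * lam ^+ k) * (lam * m%:R * k%:R + 1) ^+ n in
  cvgn (series u) /\
  dowling m lam n x = expR (- (x / (lam * m%:R))) * limn (series u).
Proof.
move=> u; set t := x / (lam * m%:R).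
have m0 : m%:R != 0 :> R by rewrite pnatr_eq0 -lt0n.
have xE : x = m%:R * lam * t.
  by rewrite /t [RHS]mulrC [m%:R * lam]mulrC divfK// mulf_neq0.
have uE k : u k = \sum_(j < n.+1) whitney2 m lam n j * (m%:R * lam) ^+ j *
    (t ^+ k / k`!%:R * (k ^_ j)%:R).
  have -> : u k = t ^+ k / k`!%:R * ((m%:R *: 'X + 1) ^+ n).[lam * k%:R].
    rewrite horner_exp !hornerE /u /t expr_div_n exprMn /=.
    by congr (_ * _ ^+ n); rewrite ?invfM; ring.
  rewrite (whitney2P R m lam n hm).
  rewrite horner_sum mulr_sumr; apply: eq_bigr => j _.
  rewrite hornerZ horner_gfalling gfalling_mul_nat [(m%:R * lam) ^+ j]exprMn.
  by ring.
(* The sum over [j] is finite, so it is exchanged with the partial sums before passing to the limit;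
   no interchange of infinite sums is needed. *)
have uS : series u @ \oo --> dowling m lam n x * expR t.
  have -> : series u = fun N => \sum_(j < n.+1)
      whitney2 m lam n j * (m%:R * lam) ^+ j *
      series (fun k => t ^+ k / k`!%:R * (k ^_ j)%:R) N.
    apply/funext => N; rewrite /series /=.
    under eq_bigr do rewrite uE.
    by rewrite exchange_big; apply: eq_bigr => j _; rewrite mulr_sumr.
  rewrite /dowling mulr_suml.
  apply: cvg_big => [|j _]; first exact: add_continuous.
  (* Since [x = m lam t], the factor [(m lam) ^ j] from the expansion and [t ^ j] from the moment
     recombine into [x ^ j]. *)
  have -> : whitney2 m lam n j * x ^+ j * expR t =
      whitney2 m lam n j * (m%:R * lam) ^+ j * (t ^+ j * expR t).
    by rewrite [X in X ^+ j]xE exprMn !mulrA.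
  by apply: cvgMl_tmp; exact: cvg_series_exp_ffact.
split; first by apply/cvg_ex; exists (dowling m lam n x * expR t).
by rewrite (cvg_lim _ uS)// mulrCA -expRD addNr expR0 mulr1.
Qed.
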